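(* Let $a\in C^1((0,\infty))$ be positive, let $T>0$, and let $u\in C([0,T)\times[0,1])\cap C^{1,2}((0,T)\times[0,1])$ be (the first component of) a classical solution to the quasilinear Smoluchowski-Poisson system with diffusion coefficient $a$ and initial condition $u_0$, $M=\langle u_0\rangle$, such that $u>0$ in $[0,T)\times(0,1)$. Define $$U(t,x):=\int_0^x u(t,z)\,dz,\qquad (t,x)\in[0,T)\times[0,1],$$ and, for each $t\in[0,T)$, let $F(t,\cdot):[0,M]\to[0,1]$ be the inverse function of $U(t,\cdot):[0,1]\to[0,M]$, i.e. $U(t,F(t,y))=y$ for $(t,y)\in[0,T)\times[0,M]$. Then the function $f:=\partial_y F$ belongs to $C([0,T)\times[0,M])\cap C^{1,2}((0,T)\times[0,M])$ and is a classical solution to $$\partial_t f=\partial_y^2\Psi(f)-1+Mf,\qquad (t,y)\in(0,T)\times(0,M),$$ $$\partial_y f(t,0)=\partial_y f(t,M)=0,\qquad t\in(0,T),$$ $$f(0,y)=\frac{1}{u_0(F(0,y))},\qquad y\in(0,M),$$ where $\Psi:(0,\infty)\to\mathbb{R}$ is defined by $\Psi(1)=0$ and $\Psi'(r)=\frac{1}{r^2}\,a\!\left(\frac1r\right)$ for $r>0$. Moreover, $f$ satisfies the conservation of mass $$\int_0^M f(t,y)\,dy=1,\qquad t\in(0,T).$$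
   Context: For an integrable function $g$ on a bounded interval $I$, $\langle g\rangle:=\frac{1}{|I|}\int_I g(x)\,dx$. Given a positive $a\in C^1((0,\infty))$ with indefinite integral $A$ (i.e. $A'=a$) and $u_0\in C([0,1])$ with $M=\langle u_0\rangle$, the one-dimensional quasilinear Smoluchowski-Poisson system on $(0,T)\times(0,1)$ for the unknowns $(u,v)$ is $$\partial_t u=\partial_x\big(a(u)\,\partial_x u-u\,\partial_x v\big),\qquad 0=\partial_x^2 v+u-M\quad\text{in }(0,T)\times(0,1),$$ $$\partial_x A(u)(t,0)=\partial_x A(u)(t,1)=\partial_x v(t,0)=\partial_x v(t,1)=0\quad\text{for } t\in(0,T),$$ $$u(0)=u_0\ge 0\ \text{ in }(0,1),\qquad \langle v(t)\rangle=0\ \text{ for } t\in(0,T).$$ Here $C^{1,2}$ means continuously differentiable once in time $t$ and twice in the space variable.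
   Formalization: Continuity of f on [0,T)×[0,M] is claimed only off corners (0,0), (0,M) where u_0 vanishes at the matching endpoint (there ∂_yF=+∞ and f→+∞); u>0 is also required at x=0,1 for t>0, so that A(u) is defined. *)

(* Defs.v *)
(* Stdlib reals with Coquelicot. *)
From Stdlib Require Import Reals.
From Coquelicot Require Import Coquelicot.
Open Scope R_scope.

Definition mean (g : R -> R) (x0 x1 : R) : R := RInt g x0 x1 / (x1 - x0).

Definition icc (x0 x1 : R) : R -> Prop := fun x => x0 <= x <= x1.
Definition ioo (x0 x1 : R) : R -> Prop := fun x => x0 < x < x1.

(* Derivative at [x] of [g] as a function on the set [S] alone: one-sided at an
   endpoint of an interval, and insensitive to the values of [g] outside [S].
   The value [l] may be infinite. *)
Definition is_deriv_on (S : R -> Prop) (g : R -> R) (x : R) (l : Rbar) : Prop :=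
  filterlim (fun z => (g z - g x) / (z - x))
    (within S (locally' x)) (Rbar_locally l).

Definition cont2_on (D : R -> R -> Prop) (w : R -> R -> R) : Prop :=
  continuous_on (fun p : R * R => D (fst p) (snd p))
    (fun p : R * R => w (fst p) (snd p)).

Definition rect (I J : R -> Prop) : R -> R -> Prop := fun t x => I t /\ J x.

Definition C12_on (I J : R -> Prop) (w : R -> R -> R) : Prop :=
  exists wt wx wxx : R -> R -> R,
    (forall t x, I t -> J x ->
       is_deriv_on I (fun s => w s x) t (wt t x)
       /\ is_deriv_on J (w t) x (wx t x)
       /\ is_deriv_on J (wx t) x (wxx t x))
    /\ cont2_on (rect I J) w /\ cont2_on (rect I J) wt
    /\ cont2_on (rect I J) wx /\ cont2_on (rect I J) wxx.

Definition C2_on (J : R -> Prop) (w : R -> R) : Prop :=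
  exists wx wxx : R -> R,
    (forall x, J x -> is_deriv_on J w x (wx x) /\ is_deriv_on J wx x (wxx x))
    /\ continuous_on J w /\ continuous_on J wx /\ continuous_on J wxx.

(* [a] and [A] are functions on (0,oo), represented by total functions whose
   values on (-oo,0] are irrelevant.  Since [a u] and [A u] occur in the
   equation and in the boundary conditions, [u] has to take its values in
   (0,oo) on (0,T) x [0,1]; nothing of the kind is required at [t = 0]. *)
Record SP_solution (a A : R -> R) (T : R) (u0 : R -> R) (u v : R -> R -> R)
  : Prop := {
  SP_u_cont : cont2_on (fun t x => 0 <= t < T /\ 0 <= x <= 1) u;
  SP_u_C12 : C12_on (ioo 0 T) (icc 0 1) u;
  SP_v_C2 : forall t, 0 < t < T -> C2_on (icc 0 1) (v t);
  SP_u_dom : forall t x, 0 < t < T -> 0 <= x <= 1 -> 0 < u t x;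
  SP_eq_u : forall t x, 0 < t < T -> 0 < x < 1 ->
    Derive (fun s => u s x) t
    = Derive (fun z => a (u t z) * Derive (u t) z - u t z * Derive (v t) z) x;
  SP_eq_v : forall t x, 0 < t < T -> 0 < x < 1 ->
    0 = Derive_n (v t) 2 x + u t x - mean u0 0 1;
  SP_bc : forall t, 0 < t < T ->
    is_deriv_on (icc 0 1) (fun x => A (u t x)) 0 0
    /\ is_deriv_on (icc 0 1) (fun x => A (u t x)) 1 0
    /\ is_deriv_on (icc 0 1) (v t) 0 0
    /\ is_deriv_on (icc 0 1) (v t) 1 0;
  SP_init : forall x, 0 < x < 1 -> u 0 x = u0 x /\ 0 <= u0 x;
  SP_v_mean : forall t, 0 < t < T -> mean (v t) 0 1 = 0
}.

Definition cumul (u : R -> R -> R) (t x : R) : R := RInt (u t) 0 x.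

(* [0,T) x [0,M] without the corners (0,y), y = 0 or y = M, at which u0
   vanishes: there the derivative of [F 0] is +oo. *)
Definition f_dom (T M : R) (u0 : R -> R) (F : R -> R -> R) : R -> R -> Prop :=
  fun t y => 0 <= t < T /\ 0 <= y <= M /\ (t = 0 -> 0 < u0 (F 0 y)).

(* Main.v *)
(* Elliptic equation and Neumann condition for v give v_x = M x - U, which at
   x = 1 is conservation of mass for u; integrating the parabolic equation then
   gives U_t = a(u) u_x - u (M x - U).  Hence the inverse function F satisfies
   F_y = 1/u and F_t = - U_t / u at x = F(t,y), so that f = 1 / u(t, F(t,y)),
   and the equation for f follows from the chain rule.  Derivatives at the ends
   of an interval are obtained, by the mean value theorem, as limits of interior
   derivatives. *)
Require Import Defs.
From Stdlib Require Import Reals Lra.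
From Coquelicot Require Import Coquelicot.
Open Scope R_scope.

(** Two difficulties shape the argument. The initial datum may vanish at [x = 0] or [x = 1], and
    then [F] has no finite derivative at the matching corner of the rectangle. So joint continuity
    of [F], and then of [u(t, F(t,y))], is established up to [t = 0] and up to both ends without
    differentiating [F], from the monotonicity of [U] in [x] and its continuity in [t]. The
    reciprocal is taken only afterwards; a zero of the density at a corner then appears as [f]
    tending to infinity there. The second difficulty is that the chain rule in two variables and
    differentiation under the integral ask for full neighbourhoods, while [u] is controlled only for
    [x] in [0,1]. For integrals, functions of [x] are extended constantly beyond the interval. For
    the time derivative of [f], the edges [y = 0] and [y = M] are treated apart: there [F] stays at
    0 or 1 and the flux vanishes. *)

Lemma continuous_on_R_iff (D : R -> Prop) (g : R -> R) :
  continuous_on D g <->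
  forall x, D x -> forall eps, 0 < eps -> exists del, 0 < del /\
    forall z, D z -> Rabs (z - x) < del -> Rabs (g z - g x) < eps.
Proof.
split.
- intros H x Dx eps He.
  specialize (H x Dx).
  apply (proj1 (filterlim_locally _ _)) with (eps := mkposreal eps He) in H.
  destruct H as [d Hd]; exists d; split; [apply cond_pos|].
  intros z Dz Hz; exact (Hd z Hz Dz).
- intros H x Dx; apply filterlim_locally; intros eps.
  destruct (H x Dx eps (cond_pos eps)) as [d [Hd0 Hd]].
  exists (mkposreal d Hd0); intros z Hz Dz; exact (Hd z Dz Hz).
Qed.

Lemma cont2_on_iff (D : R -> R -> Prop) (w : R -> R -> R) :
  cont2_on D w <->
  forall t x, D t x -> forall eps, 0 < eps -> exists del, 0 < del /\
    forall s z, D s z -> Rabs (s - t) < del -> Rabs (z - x) < del ->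
      Rabs (w s z - w t x) < eps.
Proof.
split.
- intros H t x Dx eps He.
  specialize (H (t, x) Dx).
  apply (proj1 (filterlim_locally _ _)) with (eps := mkposreal eps He) in H.
  destruct H as [d Hd]; exists d; split; [apply cond_pos|].
  intros s z Dz Hs Hz; exact (Hd (s, z) (conj Hs Hz) Dz).
- intros H [t x] Dx; apply filterlim_locally; intros eps.
  destruct (H t x Dx eps (cond_pos eps)) as [d [Hd0 Hd]].
  exists (mkposreal d Hd0); intros [s z] [Hs Hz] Dz; exact (Hd s z Dz Hs Hz).
Qed.

Lemma continuous_on_comp {T U V : UniformSpace} (D : T -> Prop) (E : U -> Prop)
  (h : T -> U) (g : U -> V) :
  continuous_on D h -> (forall p, D p -> E (h p)) -> continuous_on E g ->
  continuous_on D (fun p => g (h p)).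
Proof.
intros Hh HE Hg p Dp.
apply filterlim_comp with (2 := Hg (h p) (HE p Dp)).
intros P HP; specialize (Hh p Dp _ HP).
unfold within, filtermap in *.
apply filter_imp with (2 := Hh); intros q K Dq; apply K; auto.
Qed.

Lemma continuous_on_pair {T U V : UniformSpace} (D : T -> Prop)
  (g : T -> U) (h : T -> V) :
  continuous_on D g -> continuous_on D h ->
  continuous_on D (fun p => (g p, h p)).
Proof.
intros Hg Hh p Dp.
apply filterlim_locally; intros eps.
assert (Kg := proj1 (filterlim_locally _ _) (Hg p Dp) eps).
assert (Kh := proj1 (filterlim_locally _ _) (Hh p Dp) eps).
apply filter_imp with (2 := filter_and _ _ Kg Kh).
intros q [H1 H2]; split; assumption.
Qed.

Lemma continuous_on_comp_cont2 {T : UniformSpace} (D : T -> Prop)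
  (E : R -> R -> Prop) (g h : T -> R) (w : R -> R -> R) :
  continuous_on D g -> continuous_on D h -> (forall p, D p -> E (g p) (h p)) ->
  cont2_on E w -> continuous_on D (fun p => w (g p) (h p)).
Proof.
intros Hg Hh HE Hw.
apply (continuous_on_comp D (fun q => E (fst q) (snd q)) (fun p => (g p, h p))
  (fun q => w (fst q) (snd q))); auto.
now apply continuous_on_pair.
Qed.

Lemma continuous_on_plus {T : UniformSpace} (D : T -> Prop) (g h : T -> R) :
  continuous_on D g -> continuous_on D h ->
  continuous_on D (fun p => g p + h p).
Proof.
intros Hg Hh p Dp.
exact (filterlim_comp_2 _ _ _ (Hg p Dp) (Hh p Dp) (filterlim_plus (g p) (h p))).
Qed.

Lemma continuous_on_opp {T : UniformSpace} (D : T -> Prop) (g : T -> R) :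
  continuous_on D g -> continuous_on D (fun p => - g p).
Proof.
intros Hg p Dp.
exact (filterlim_comp _ _ _ _ _ _ _ _ (Hg p Dp) (filterlim_opp (g p))).
Qed.

Lemma continuous_on_minus {T : UniformSpace} (D : T -> Prop) (g h : T -> R) :
  continuous_on D g -> continuous_on D h ->
  continuous_on D (fun p => g p - h p).
Proof.
intros Hg Hh; apply continuous_on_plus; auto; now apply continuous_on_opp.
Qed.

Lemma continuous_on_mult {T : UniformSpace} (D : T -> Prop) (g h : T -> R) :
  continuous_on D g -> continuous_on D h ->
  continuous_on D (fun p => g p * h p).
Proof.
intros Hg Hh p Dp.
exact (filterlim_comp_2 _ _ _ (Hg p Dp) (Hh p Dp) (filterlim_mult (g p) (h p))).
Qed.

Lemma continuous_on_pow {T : UniformSpace} (D : T -> Prop) (g : T -> R) (n : nat) :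
  continuous_on D g -> continuous_on D (fun p => g p ^ n).
Proof.
intros Hg; induction n as [|n IH].
- apply continuous_on_forall; intros; apply continuous_const.
- now apply continuous_on_mult.
Qed.

Lemma continuous_on_inv {T : UniformSpace} (D : T -> Prop) (g : T -> R) :
  continuous_on D g -> (forall p, D p -> g p <> 0) ->
  continuous_on D (fun p => / g p).
Proof.
intros Hg H0 p Dp.
apply (filterlim_comp _ _ _ _ _ _ _ _ (Hg p Dp)).
apply (filterlim_Rbar_inv (Finite (g p))).
intros K; injection K; apply H0, Dp.
Qed.

Lemma continuous_on_div {T : UniformSpace} (D : T -> Prop) (g h : T -> R) :
  continuous_on D g -> continuous_on D h -> (forall p, D p -> h p <> 0) ->
  continuous_on D (fun p => g p / h p).
Proof.
intros Hg Hh H0; apply continuous_on_mult; auto; now apply continuous_on_inv.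
Qed.

Lemma continuous_on_const {T : UniformSpace} (D : T -> Prop) (c : R) :
  continuous_on D (fun _ => c).
Proof. apply continuous_on_forall; intros; apply continuous_const. Qed.

Lemma continuous_on_comp_continuous {T : UniformSpace} (D : T -> Prop)
  (g : T -> R) (h : R -> R) :
  continuous_on D g -> (forall p, D p -> continuous h (g p)) ->
  continuous_on D (fun p => h (g p)).
Proof.
intros Hg Hh p Dp.
exact (filterlim_comp _ _ _ _ _ _ _ _ (Hg p Dp) (Hh p Dp)).
Qed.

Lemma continuous_on_fst (D : R * R -> Prop) : continuous_on D (fun p => fst p).
Proof. apply continuous_on_forall; intros [t x] _; apply continuous_fst. Qed.

Lemma continuous_on_snd (D : R * R -> Prop) : continuous_on D (fun p => snd p).
Proof. apply continuous_on_forall; intros [t x] _; apply continuous_snd. Qed.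

Lemma continuous_on_id (D : R -> Prop) : continuous_on D (fun x => x).
Proof. apply continuous_on_forall; intros x _; apply continuous_id. Qed.

Lemma cont2_on_slice (D : R -> R -> Prop) (w : R -> R -> R) (t : R)
  (J : R -> Prop) :
  cont2_on D w -> (forall x, J x -> D t x) -> continuous_on J (w t).
Proof.
intros Hw HD.
apply (continuous_on_comp_cont2 J D (fun _ => t) (fun x => x) w); auto.
apply continuous_on_const. apply continuous_on_id.
Qed.

(** * Derivatives relative to a set *)

Lemma locally_ioo (a b x : R) : a < x < b -> locally x (ioo a b).
Proof.
intros H.
apply (locally_interval (ioo a b) x (Finite a) (Finite b)); simpl; try lra.
intros y; simpl; intros; split; lra.
Qed.

Lemma locally_icc (a b x : R) : a < x < b -> locally x (icc a b).
Proof.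
intros H; apply filter_imp with (2 := locally_ioo a b x H).
unfold ioo, icc; intros; lra.
Qed.

Lemma is_deriv_on_iff (S : R -> Prop) (g : R -> R) (x l : R) :
  is_deriv_on S g x l <->
  forall eps, 0 < eps -> exists del, 0 < del /\
    forall z, S z -> z <> x -> Rabs (z - x) < del ->
      Rabs ((g z - g x) / (z - x) - l) < eps.
Proof.
split.
- intros H eps He.
  assert (K := H (fun y => Rabs (y - l) < eps)).
  destruct K as [d Hd].
  + exists (mkposreal eps He); intros y Hy; exact Hy.
  + exists d; split; [apply cond_pos|].
    intros z Sz Hz Hd'; exact (Hd z Hd' Hz Sz).
- intros H P [eps HP].
  destruct (H eps (cond_pos eps)) as [d [Hd0 Hd]].
  exists (mkposreal d Hd0); intros z Hz Hzx Sz.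
  apply HP, (Hd z Sz Hzx Hz).
Qed.

Lemma is_derive_of_is_deriv_on (S : R -> Prop) (g : R -> R) (x l : R) :
  locally x S -> is_deriv_on S g x l -> is_derive g x l.
Proof.
intros [d1 H1] H; apply is_derive_Reals; intros eps He.
destruct (proj1 (is_deriv_on_iff S g x l) H eps He) as [d2 [Hd2 H2]].
assert (Hm : 0 < Rmin d1 d2) by (apply Rmin_pos; auto; apply cond_pos).
exists (mkposreal _ Hm); simpl; intros h Hh0 Hh.
assert (K := Rmin_l d1 d2); assert (K' := Rmin_r d1 d2).
replace ((g (x + h) - g x) / h) with ((g (x + h) - g x) / (x + h - x))
  by (f_equal; ring).
apply H2.
- apply H1. change (Rabs (x + h - x) < d1). replace (x + h - x) with h by ring; lra.
- lra.
- replace (x + h - x) with h by ring; lra.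
Qed.

Lemma is_derive_eq (g : R -> R) (x l1 l2 : R) :
  is_derive g x l1 -> l1 = l2 -> is_derive g x l2.
Proof. intros H <-; exact H. Qed.

Lemma is_derive_is_deriv_on (S : R -> Prop) (g : R -> R) (x l : R) :
  is_derive g x l -> is_deriv_on S g x l.
Proof.
intros H; apply is_deriv_on_iff; intros eps He.
destruct (proj1 (is_derive_Reals _ _ _) H eps He) as [d Hd].
exists d; split; [apply cond_pos|].
intros z _ Hz Hzd.
specialize (Hd (z - x) ltac:(lra) Hzd).
now replace (x + (z - x)) with z in Hd by ring.
Qed.

(** Every point of a nondegenerate interval, ends included, is a limit of other points of it. This
    is what identifies the boundary data, stated as one-sided derivatives, with the end values of
    the continuous derivatives of [u] and [v]. *)
Lemma is_deriv_on_unique (a b : R) (g : R -> R) (x l1 l2 : R) :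
  a < b -> a <= x <= b -> is_deriv_on (icc a b) g x l1 ->
  is_deriv_on (icc a b) g x l2 -> l1 = l2.
Proof.
intros Hab Hx H1 H2; apply Req_lt_aux; intros [eps He]; simpl.
destruct (proj1 (is_deriv_on_iff _ _ _ _) H1 (eps / 2) ltac:(lra)) as [d1 [P1 K1]].
destruct (proj1 (is_deriv_on_iff _ _ _ _) H2 (eps / 2) ltac:(lra)) as [d2 [P2 K2]].
assert (Hz : exists z, icc a b z /\ z <> x /\ Rabs (z - x) < d1 /\ Rabs (z - x) < d2).
{ assert (Q1 := Rmin_l d1 d2); assert (Q2 := Rmin_r d1 d2).
  assert (Q3 : 0 < Rmin d1 d2) by (apply Rmin_pos; auto).
  set (m := Rmin d1 d2) in *.
  (* The test point lies to the right of [x], except at [x = b], where it lies to the left. *)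
  destruct (Rlt_dec x b) as [Hxb|Hxb].
  - assert (Q4 := Rmin_l (m / 2) (b - x)); assert (Q5 := Rmin_r (m / 2) (b - x)).
    assert (0 < Rmin (m / 2) (b - x)) by (apply Rmin_pos; lra).
    set (k := Rmin (m / 2) (b - x)) in *.
    exists (x + k); unfold icc; replace (x + k - x) with k by ring.
    rewrite Rabs_pos_eq by lra; lra.
  - assert (Q4 := Rmin_l (m / 2) (x - a)); assert (Q5 := Rmin_r (m / 2) (x - a)).
    assert (0 < Rmin (m / 2) (x - a)) by (apply Rmin_pos; lra).
    set (k := Rmin (m / 2) (x - a)) in *.
    exists (x - k); unfold icc; replace (x - k - x) with (- k) by ring.
    rewrite Rabs_Ropp, Rabs_pos_eq by lra; lra. }
destruct Hz as [z [Sz [Hzx [Z1 Z2]]]].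
specialize (K1 z Sz Hzx Z1); specialize (K2 z Sz Hzx Z2).
apply Rabs_def2 in K1; apply Rabs_def2 in K2.
apply Rabs_def1; lra.
Qed.

(** * Constant extension from an interval, mean value theorem, fundamental theorem of calculus *)

Definition clamp (a b x : R) : R := Rmax a (Rmin b x).

Lemma clamp_icc (a b x : R) : a <= b -> a <= clamp a b x <= b.
Proof.
intros H; unfold clamp; split; [apply Rmax_l|].
apply Rmax_lub; auto; apply Rmin_l.
Qed.

Lemma clamp_id (a b x : R) : a <= x <= b -> clamp a b x = x.
Proof.
intros H; unfold clamp; rewrite Rmin_right by lra; apply Rmax_right; lra.
Qed.

Lemma clamp_lip (a b x y : R) : Rabs (clamp a b x - clamp a b y) <= Rabs (x - y).
Proof.
assert (H : forall p q r, Rabs (Rmin p q - Rmin p r) <= Rabs (q - r)).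
{ intros p q r; unfold Rmin; destruct (Rle_dec p q), (Rle_dec p r);
  split_Rabs; lra. }
unfold clamp; apply Rle_trans with (2 := H b x y).
generalize (Rmin b x) (Rmin b y); intros p q.
unfold Rmax; destruct (Rle_dec a p), (Rle_dec a q);
  split_Rabs; lra.
Qed.

(** Projection onto the interval is 1-Lipschitz, so continuity relative to [a,b] becomes continuity
    on the whole line with the values on [a,b] unchanged. Results on total functions then apply. *)
Lemma continuous_clamp (a b : R) (g : R -> R) (x : R) :
  a <= b -> continuous_on (icc a b) g ->
  continuous (fun z => g (clamp a b z)) x.
Proof.
intros Hab Hg.
apply filterlim_locally; intros eps.
destruct (proj1 (continuous_on_R_iff _ _) Hg (clamp a b x) (clamp_icc a b x Hab)
  eps (cond_pos eps)) as [d [Hd0 Hd]].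
exists (mkposreal d Hd0); intros z Hz.
apply Hd; [now apply clamp_icc|].
apply Rle_lt_trans with (1 := clamp_lip a b z x); exact Hz.
Qed.

Lemma is_derive_clamp (a b : R) (g : R -> R) (x l : R) :
  a < x < b -> is_derive g x l -> is_derive (fun z => g (clamp a b z)) x l.
Proof.
intros Hx; apply is_derive_ext_loc.
apply filter_imp with (2 := locally_icc a b x Hx).
intros z Hz; now rewrite clamp_id.
Qed.

Lemma MVT_on (a b : R) (g h : R -> R) :
  a < b -> continuous_on (icc a b) g ->
  (forall z, a < z < b -> is_derive g z (h z)) ->
  exists c, a < c < b /\ g b - g a = h c * (b - a).
Proof.
intros Hab Hg Hd.
assert (pr1 : forall c, a < c < b -> derivable_pt (fun z => g (clamp a b z)) c).
{ intros c Hc; exists (h c); apply is_derive_Reals, is_derive_clamp; auto. }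
assert (pr2 : forall c, a < c < b -> derivable_pt id c).
{ intros c _; apply derivable_pt_id. }
destruct (MVT _ _ a b pr1 pr2 Hab) as [c [P Hc]].
- intros c _; apply continuity_pt_filterlim, (continuous_clamp a b g c); auto; lra.
- intros c _; apply derivable_continuous_pt, derivable_pt_id.
- exists c; split; auto.
  rewrite !clamp_id in Hc by lra.
  rewrite (derive_pt_eq_0 _ c (h c)) in Hc
    by (apply is_derive_Reals, is_derive_clamp; auto).
  rewrite (derive_pt_eq_0 _ c 1) in Hc by apply derivable_pt_lim_id.
  unfold id in Hc; lra.
Qed.

Lemma icc_sub (a b c d : R) : a <= c -> d <= b -> forall x, icc c d x -> icc a b x.
Proof. unfold icc; intros; lra. Qed.

(** The two points come in either order, and the distance bound makes [c] tend to [x] together with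
    [z]. As [c] is interior, [x] itself may be an end at which nothing is known of the
    derivative. *)
Lemma MVT_slope (a b : R) (g h : R -> R) (x z : R) :
  continuous_on (icc a b) g ->
  (forall c, a < c < b -> is_derive g c (h c)) ->
  a <= x <= b -> a <= z <= b -> x <> z ->
  exists c, a < c < b /\ Rabs (c - x) <= Rabs (z - x) /\
    (g z - g x) = h c * (z - x).
Proof.
intros Hg Hd Hx Hz Hxz.
destruct (Rlt_dec x z) as [L|L].
- destruct (MVT_on x z g h) as [c [Hc E]]; auto.
  + apply continuous_on_subset with (2 := Hg); apply icc_sub; lra.
  + intros; apply Hd; lra.
  + exists c; repeat split; auto; try lra. rewrite !Rabs_pos_eq; lra.
- destruct (MVT_on z x g h) as [c [Hc E]]; auto; try lra.
  + apply continuous_on_subset with (2 := Hg); apply icc_sub; lra.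
  + intros; apply Hd; lra.
  + exists c; repeat split; auto; try lra. rewrite !Rabs_left; lra.
Qed.

Lemma is_deriv_on_of_interior (a b : R) (g h : R -> R) (x : R) :
  continuous_on (icc a b) g ->
  (forall z, a < z < b -> is_derive g z (h z)) ->
  continuous_on (icc a b) h -> a <= x <= b ->
  is_deriv_on (icc a b) g x (h x).
Proof.
intros Hg Hd Hh Hx; apply is_deriv_on_iff; intros eps He.
destruct (proj1 (continuous_on_R_iff _ _) Hh x Hx eps He) as [d [Hd0 K]].
exists d; split; auto; intros z Sz Hzx Hz.
destruct (MVT_slope a b g h x z) as [c [Hc [Hcx E]]]; auto.
rewrite E.
replace (h c * (z - x) / (z - x)) with (h c) by (field; lra).
apply K; [unfold icc; lra | lra].
Qed.

Lemma RInt_clamp (a b : R) (h : R -> R) (x : R) :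
  a <= x <= b -> RInt (fun z => h (clamp a b z)) a x = RInt h a x.
Proof.
intros Hx; apply RInt_ext; intros z Hz.
rewrite Rmin_left, Rmax_right in Hz by lra.
now rewrite clamp_id by lra.
Qed.

Lemma is_derive_RInt_clamp (a b : R) (h : R -> R) (x : R) :
  a <= b -> continuous_on (icc a b) h ->
  is_derive (fun z => RInt (fun y => h (clamp a b y)) a z) x (h (clamp a b x)).
Proof.
intros Hab Hh.
apply (is_derive_RInt (fun y => h (clamp a b y)) _ a x).
- apply filter_forall; intros z; apply (RInt_correct (V := R_CompleteNormedModule)), ex_RInt_continuous.
  intros; now apply continuous_clamp.
- now apply continuous_clamp.
Qed.

(** The difference between [g] and the primitive of the extended [h] has zero derivative inside and
    is continuous up to the ends, so the mean value theorem gives it equal end values. *)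
Lemma is_RInt_of_interior (a b : R) (g h : R -> R) :
  a < b -> continuous_on (icc a b) g ->
  (forall z, a < z < b -> is_derive g z (h z)) ->
  continuous_on (icc a b) h -> is_RInt h a b (g b - g a).
Proof.
intros Hab Hg Hd Hh.
set (hc := fun y => h (clamp a b y)).
assert (Hex : ex_RInt hc a b).
{ apply (ex_RInt_continuous (V := R_CompleteNormedModule)); intros; apply continuous_clamp; auto; lra. }
assert (HI : RInt hc a b = g b - g a).
{ destruct (MVT_on a b (fun x => g x - RInt hc a x)
    (fun x => h x - hc x)) as [c [Hc E]]; auto.
  - apply continuous_on_minus; auto.
    apply continuous_on_forall; intros x _; apply (ex_derive_continuous (V := R_NormedModule)).
    eexists; apply is_derive_RInt_clamp; auto; lra.
  - intros z Hz; apply (is_derive_minus (V := R_NormedModule)); auto.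
    apply is_derive_RInt_clamp; auto; lra.
  - unfold hc at 3 in E; rewrite clamp_id in E by lra.
    rewrite RInt_point in E; unfold zero in E; simpl in E; lra. }
rewrite <- HI.
apply is_RInt_ext with hc.
- intros x; rewrite Rmin_left, Rmax_right by lra; intros Hx; unfold hc.
  now rewrite clamp_id by lra.
- now apply (RInt_correct (V := R_CompleteNormedModule)).
Qed.

(** * From the open interval to its ends *)

Lemma continuous_on_icc_nonneg (b0 b1 : R) (g : R -> R) :
  b0 < b1 -> continuous_on (icc b0 b1) g ->
  (forall x, b0 < x < b1 -> 0 <= g x) -> forall x, b0 <= x <= b1 -> 0 <= g x.
Proof.
intros Hb Hg H x Hx; apply Rnot_lt_le; intros C.
destruct (proj1 (continuous_on_R_iff _ _) Hg x Hx (- g x) ltac:(lra)) as [d [Hd K]].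
(* [x] is moved by the fraction [r] of the way to the midpoint: a positive weight on the midpoint
   makes the new point interior, and the displacement is at most [r] times half the length, hence
   below [d]. *)
set (r := Rmin 1 (d / (b1 - b0))).
assert (Hr : 0 < r <= 1).
{ split; [|apply Rmin_l].
  apply Rmin_pos; [lra|]; apply Rdiv_lt_0_compat; lra. }
assert (Hrd : r * (b1 - b0) <= d).
{ apply Rle_trans with (d / (b1 - b0) * (b1 - b0)).
  - apply Rmult_le_compat_r; [lra | apply Rmin_r].
  - right; field; lra. }
assert (Hz : b0 < x + r * ((b0 + b1) / 2 - x) < b1) by nra.
specialize (K _ (conj (Rlt_le _ _ (proj1 Hz)) (Rlt_le _ _ (proj2 Hz)))).
assert (K' := H _ Hz).
set (z := x + r * ((b0 + b1) / 2 - x)) in *.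
assert (Hzx : Rabs (z - x) < d) by (unfold z; apply Rabs_def1; nra).
specialize (K Hzx); apply Rabs_def2 in K; lra.
Qed.

Lemma continuous_on_icc_eq (b0 b1 : R) (g h : R -> R) :
  b0 < b1 -> continuous_on (icc b0 b1) g -> continuous_on (icc b0 b1) h ->
  (forall x, b0 < x < b1 -> g x = h x) -> forall x, b0 <= x <= b1 -> g x = h x.
Proof.
intros Hb Hg Hh H x Hx.
assert (K1 := continuous_on_icc_nonneg b0 b1 (fun z => g z - h z) Hb
  (continuous_on_minus _ _ _ Hg Hh)
  (fun z Hz => Req_le _ _ (eq_sym (Rminus_diag_eq _ _ (H z Hz)))) x Hx).
assert (K2 := continuous_on_icc_nonneg b0 b1 (fun z => h z - g z) Hb
  (continuous_on_minus _ _ _ Hh Hg)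
  (fun z Hz => Req_le _ _ (eq_sym (Rminus_diag_eq _ _ (eq_sym (H z Hz))))) x Hx).
simpl in K1, K2; lra.
Qed.

(** * The inverse of the primitive of a density *)

Section Slice.

Variables (w : R -> R) (M : R).
Hypothesis w_cont : continuous_on (icc 0 1) w.
Hypothesis w_pos : forall x, 0 < x < 1 -> 0 < w x.
Hypothesis w_mass : RInt w 0 1 = M.

Lemma primitive_continuous_on : continuous_on (icc 0 1) (RInt w 0).
Proof.
apply continuous_on_ext with (fun x => RInt (fun z => w (clamp 0 1 z)) 0 x).
- intros x Hx; exact (RInt_clamp 0 1 w x Hx).
- apply continuous_on_forall; intros x _.
  apply (ex_derive_continuous (V := R_NormedModule)).
  eexists; apply is_derive_RInt_clamp; auto; lra.
Qed.

Lemma is_derive_primitive (x : R) : 0 < x < 1 -> is_derive (RInt w 0) x (w x).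
Proof.
intros Hx.
apply is_derive_ext_loc with (fun x => RInt (fun z => w (clamp 0 1 z)) 0 x).
- apply filter_imp with (2 := locally_icc 0 1 x Hx).
  intros z Hz; exact (RInt_clamp 0 1 w z Hz).
- replace (w x) with (w (clamp 0 1 x)) by (rewrite clamp_id; auto; lra).
  apply is_derive_RInt_clamp; auto; lra.
Qed.

Lemma primitive_at_0 : RInt w 0 0 = 0.
Proof. exact (RInt_point 0 w). Qed.

(** The mean value point is interior, so zeros of [w] at 0 or 1 do not spoil strictness. *)
Lemma primitive_lt (x z : R) : 0 <= x -> x < z -> z <= 1 -> RInt w 0 x < RInt w 0 z.
Proof.
intros Hx Hxz Hz.
destruct (MVT_on x z (RInt w 0) w) as [c [Hc E]]; auto.
- apply continuous_on_subset with (2 := primitive_continuous_on); apply icc_sub; lra.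
- intros; apply is_derive_primitive; lra.
- assert (0 < w c * (z - x)) by (apply Rmult_lt_0_compat; [apply w_pos|]; lra).
  lra.
Qed.

Lemma primitive_range (x : R) : 0 <= x <= 1 -> 0 <= RInt w 0 x <= M.
Proof.
intros Hx; assert (K := primitive_at_0).
split.
- destruct (Req_dec x 0) as [->|H]; [lra|].
  assert (L := primitive_lt 0 x); lra.
- destruct (Req_dec x 1) as [->|H]; [lra|].
  assert (L := primitive_lt x 1); lra.
Qed.

Lemma mass_pos : 0 < M.
Proof. assert (K := primitive_at_0); assert (L := primitive_lt 0 1); lra. Qed.

Lemma primitive_inj (x z : R) :
  0 <= x <= 1 -> 0 <= z <= 1 -> RInt w 0 x = RInt w 0 z -> x = z.
Proof.
intros Hx Hz E; destruct (Rtotal_order x z) as [H|[H|H]]; auto.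
- assert (L := primitive_lt x z); lra.
- assert (L := primitive_lt z x); lra.
Qed.

Lemma primitive_surj (y : R) :
  0 <= y <= M -> exists x, 0 <= x <= 1 /\ RInt w 0 x = y.
Proof.
intros Hy.
set (W := fun x => RInt w 0 (clamp 0 1 x)).
assert (W0 : W 0 = 0) by (unfold W; rewrite clamp_id by lra; apply primitive_at_0).
assert (W1 : W 1 = M) by (unfold W; rewrite clamp_id by lra; auto).
destruct (IVT_gen_consistent W 0 1 y) as [x [Hx E]].
- intros x; apply continuous_clamp; [lra|]; apply primitive_continuous_on.
- rewrite W0, W1, Rmin_left, Rmax_right; lra.
- rewrite Rmin_left, Rmax_right in Hx by lra.
  exists x; split; auto; unfold W in E; now rewrite clamp_id in E.
Qed.

Variable G : R -> R.
Hypothesis HG : forall y, 0 <= y <= M -> 0 <= G y <= 1 /\ RInt w 0 (G y) = y.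

Lemma inverse_at_0 : G 0 = 0.
Proof.
assert (K := mass_pos); destruct (HG 0) as [H1 H2]; [lra|].
apply primitive_inj; try lra. rewrite H2; symmetry; apply primitive_at_0.
Qed.

Lemma inverse_at_M : G M = 1.
Proof.
assert (K := mass_pos); destruct (HG M) as [H1 H2]; [lra|].
apply primitive_inj; lra.
Qed.

Lemma inverse_ioo (y : R) : 0 < y < M -> 0 < G y < 1.
Proof.
intros Hy; destruct (HG y) as [H1 H2]; [lra|].
assert (K := primitive_at_0).
destruct (Req_dec (G y) 0) as [E|E]; [rewrite E in H2; lra|].
destruct (Req_dec (G y) 1) as [E'|E']; [rewrite E' in H2; lra|].
lra.
Qed.

(** An exact formula for the difference quotient of the inverse. With [G] continuous, [c] tends to
    [G y] as [z] tends to [y], and the finite and the infinite derivative both follow from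
    continuity of [w] at that one point. *)
Lemma inverse_slope (y z : R) : 0 <= y <= M -> 0 <= z <= M -> y <> z ->
  exists c, 0 < c < 1 /\ Rabs (c - G y) <= Rabs (G z - G y) /\
    (G z - G y) / (z - y) = / w c.
Proof.
intros Hy Hz Hyz.
destruct (HG y Hy) as [Y1 Y2]; destruct (HG z Hz) as [Z1 Z2].
assert (HGyz : G y <> G z) by congruence.
destruct (MVT_slope 0 1 (RInt w 0) w (G y) (G z)) as [c [Hc [Hcy E]]]; auto.
- apply primitive_continuous_on.
- apply is_derive_primitive.
- exists c; repeat split; try tauto.
  rewrite Y2, Z2 in E; assert (P := w_pos c Hc).
  rewrite E; field; split; try lra.
Qed.

Hypothesis G_cont : continuous_on (icc 0 M) G.

Lemma inverse_deriv (y : R) :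
  0 <= y <= M -> 0 < w (G y) -> is_deriv_on (icc 0 M) G y (/ w (G y)).
Proof.
intros Hy Hp; apply is_deriv_on_iff; intros eps He.
assert (C : continuous (fun r => / r) (w (G y))).
{ apply (filterlim_Rbar_inv (Finite (w (G y)))); intros K; injection K; lra. }
destruct (proj1 (filterlim_locally _ _) C (mkposreal eps He)) as [d Hd].
destruct (proj1 (continuous_on_R_iff _ _) w_cont (G y) (proj1 (HG y Hy)) d (cond_pos d))
  as [d1 [Hd1 K1]].
destruct (proj1 (continuous_on_R_iff _ _) G_cont y Hy d1 Hd1) as [d2 [Hd2 K2]].
exists d2; split; auto; intros z Sz Hzy Hz.
destruct (inverse_slope y z) as [c [Hc [Hcy E]]]; auto.
rewrite E; apply Hd, K1; [unfold icc; lra|].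
apply Rle_lt_trans with (1 := Hcy); auto.
Qed.

Lemma inverse_deriv_infty (y : R) :
  0 <= y <= M -> w (G y) = 0 -> is_deriv_on (icc 0 M) G y p_infty.
Proof.
intros Hy H0 P [B HB].
(* Once [w c < m], the slope [/ w c] exceeds [Rabs B + 1], hence [B]; the absolute value and the 1
   keep [m] positive for every sign of [B]. *)
set (m := / (Rabs B + 1)).
assert (Hm : 0 < m) by (apply Rinv_0_lt_compat; assert (K := Rabs_pos B); lra).
destruct (proj1 (continuous_on_R_iff _ _) w_cont (G y) (proj1 (HG y Hy)) m Hm)
  as [d1 [Hd1 K1]].
destruct (proj1 (continuous_on_R_iff _ _) G_cont y Hy d1 Hd1) as [d2 [Hd2 K2]].
exists (mkposreal d2 Hd2); intros z Hz Hzy Sz; apply HB.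
destruct (inverse_slope y z) as [c [Hc [Hcy E]]]; auto.
rewrite E.
assert (L := K1 c ltac:(unfold icc; lra) (Rle_lt_trans _ _ _ Hcy (K2 z Sz Hz))).
assert (Pc := w_pos c Hc).
rewrite H0, Rminus_0_r, Rabs_pos_eq in L by lra.
apply Rinv_lt_contravar in L; [|now apply Rmult_lt_0_compat].
unfold m in L; rewrite Rinv_inv in L; assert (K := Rle_abs B); lra.
Qed.

End Slice.

(** * The gradient of the potential *)

Lemma potential_gradient (w V Vx Vxx : R -> R) (M : R) :
  continuous_on (icc 0 1) w -> continuous_on (icc 0 1) Vx ->
  (forall x, icc 0 1 x ->
    is_deriv_on (icc 0 1) V x (Vx x) /\ is_deriv_on (icc 0 1) Vx x (Vxx x)) ->
  (forall x, 0 < x < 1 -> 0 = Derive_n V 2 x + w x - M) ->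
  Vx 0 = 0 ->
  (forall x, 0 < x < 1 -> Derive V x = Vx x)
  /\ (forall x, 0 <= x <= 1 -> Vx x = M * x - RInt w 0 x).
Proof.
intros Hw HVx HV Heq V0.
assert (DV : forall x, 0 < x < 1 -> Derive V x = Vx x).
{ intros x Hx; apply is_derive_unique, (is_derive_of_is_deriv_on (icc 0 1)).
  - now apply locally_icc.
  - apply HV; unfold icc; lra. }
split; auto; intros x Hx.
assert (P0 := primitive_at_0 w).
destruct (Req_dec x 0) as [->|Hx0]; [rewrite V0, P0; ring|].
(* The elliptic equation reads [Vxx = M - w], so this difference is constant, and it vanishes at
   0. *)
destruct (MVT_on 0 x (fun z => Vx z - (M * z - RInt w 0 z)) (fun _ => 0))
  as [c [_ E]]; try lra.
- apply continuous_on_subset with (icc 0 1); [apply icc_sub; lra|].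
  apply continuous_on_minus; auto.
  apply continuous_on_minus; [|now apply primitive_continuous_on].
  apply continuous_on_mult; [apply continuous_on_const | apply continuous_on_id].
- intros z Hz; assert (Hz' : 0 < z < 1) by lra.
  assert (D1 : is_derive Vx z (Vxx z)).
  { apply (is_derive_of_is_deriv_on (icc 0 1)); [now apply locally_icc|].
    apply HV; unfold icc; lra. }
  assert (D2 := is_derive_primitive w Hw z Hz').
  assert (E : Derive_n V 2 z = Vxx z).
  { transitivity (Derive Vx z).
    - apply Derive_ext_loc.
      apply filter_imp with (2 := locally_ioo 0 1 z Hz'); exact DV.
    - now apply is_derive_unique. }
  specialize (Heq z Hz'); rewrite E in Heq.
  apply is_derive_eq with (Vxx z - (M - w z)); [|lra].
  apply (is_derive_minus (V := R_NormedModule)); auto.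
  apply (is_derive_minus (V := R_NormedModule)); auto.
  auto_derive; auto; ring.
Qed.

(** * Continuity in time *)

Section Evolution.

Variables (T M : R) (u : R -> R -> R).
Hypothesis u_cont : cont2_on (fun t x => 0 <= t < T /\ 0 <= x <= 1) u.
Hypothesis u_pos : forall t x, 0 <= t < T -> 0 < x < 1 -> 0 < u t x.
Hypothesis u_mass : forall t, 0 <= t < T -> RInt (u t) 0 1 = M.

Lemma slice_continuous_on (t : R) : 0 <= t < T -> continuous_on (icc 0 1) (u t).
Proof.
intros Ht; apply (cont2_on_slice _ u t (icc 0 1) u_cont); intros; split; auto.
Qed.

(** Compactness of [0,1] makes the continuity of [u] at time [t] uniform in [x], and the estimate is
    then integrated. *)
Lemma cumul_continuous_on_time (x : R) :
  0 <= x <= 1 -> continuous_on (fun t => 0 <= t < T) (fun t => cumul u t x).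
Proof.
intros Hx; apply continuous_on_R_iff; intros t Ht eps He.
(* Freezing [u] before time 0 and beyond [0,1] gives two-sided continuity also at [t = 0] and at the
   ends. *)
set (us := fun s z => u (Rmax 0 s) (clamp 0 1 z)).
assert (C : forall z, 0 <= z <= 1 -> continuity_2d_pt us t z).
{ intros z Hz e.
  destruct (proj1 (cont2_on_iff _ _) u_cont t z (conj Ht Hz) e (cond_pos e))
    as [d [Hd0 K]].
  assert (Hm : 0 < Rmin d (T - t)) by (apply Rmin_pos; lra).
  exists (mkposreal _ Hm); simpl; intros s q Hs Hq.
  assert (Q1 := Rmin_l d (T - t)); assert (Q2 := Rmin_r d (T - t)).
  unfold us; rewrite (Rmax_right 0 t), (clamp_id 0 1 z) by lra.
  assert (Hcl := clamp_lip 0 1 q z); rewrite (clamp_id 0 1 z) in Hcl by lra.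
  apply K.
  - split; [|apply clamp_icc; lra].
    split; [apply Rmax_l|]. apply Rabs_def2 in Hs; apply Rmax_lub_lt; lra.
  - apply Rle_lt_trans with (Rabs (s - t)); [|lra].
    unfold Rmax; destruct (Rle_dec 0 s); split_Rabs; lra.
  - lra. }
destruct (uniform_continuity_2d_1d' us 0 1 t C (mkposreal (eps / 2) ltac:(lra)))
  as [d Hd]; simpl in Hd.
exists d; split; [apply cond_pos|]; intros s Hs Hst.
assert (E : forall r, 0 <= r < T ->
  ex_RInt (us r) 0 x /\ cumul u r x = RInt (us r) 0 x).
{ intros r Hr; split.
  - apply (ex_RInt_continuous (V := R_CompleteNormedModule)); intros z _; unfold us.
    rewrite Rmax_right by lra.
    apply continuous_clamp; [lra | now apply slice_continuous_on].
  - unfold cumul; rewrite <- (RInt_clamp 0 1 (u r) x Hx).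
    unfold us; now rewrite Rmax_right by lra. }
destruct (E s Hs) as [Es1 Es2]; destruct (E t Ht) as [Et1 Et2].
rewrite Es2, Et2.
replace (RInt (us s) 0 x - RInt (us t) 0 x) with (RInt (fun z => us s z - us t z) 0 x)
  by exact (RInt_minus (V := R_CompleteNormedModule) (us s) (us t) 0 x Es1 Et1).
(* Since [x <= 1], this bound is at most [eps / 2], hence strictly below [eps]. *)
apply Rle_lt_trans with ((x - 0) * (eps / 2)); [|nra].
apply abs_RInt_le_const; try lra.
- exact (ex_RInt_minus (V := R_NormedModule) _ _ _ _ Es1 Et1).
- intros z Hz; apply Rlt_le, Hd; try lra.
  + assert (P := cond_pos d); lra.
  + apply Rabs_def2 in Hst; lra.
  + rewrite Rminus_diag, Rabs_R0; apply cond_pos.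
Qed.

Variable F : R -> R -> R.
Hypothesis HF : forall t y, 0 <= t < T -> 0 <= y <= M ->
  0 <= F t y <= 1 /\ cumul u t (F t y) = y.

(** At time [t] the values of [U] at [x - eps] and [x + eps] lie strictly on either side of [y].
    Continuity in time at these two fixed points preserves this for nearby [s], and monotonicity in
    space traps [F s z] between them. *)
Lemma inverse_cont2_on : cont2_on (fun t y => 0 <= t < T /\ 0 <= y <= M) F.
Proof.
apply cont2_on_iff; intros t y [Ht Hy] eps He.
assert (slt : forall s x z, 0 <= s < T -> 0 <= x -> x < z -> z <= 1 ->
  cumul u s x < cumul u s z).
{ intros s x z Hs; apply primitive_lt.
  - now apply slice_continuous_on.
  - intros; now apply u_pos. }
assert (sle : forall s x z, 0 <= s < T -> 0 <= x -> x <= z -> z <= 1 ->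
  cumul u s x <= cumul u s z).
{ intros s x z Hs Hx Hxz Hz; destruct (Req_dec x z) as [->|]; [lra|].
  apply Rlt_le, slt; lra. }
destruct (HF t y Ht Hy) as [Hx E].
set (x := F t y) in *.
assert (up : exists d, 0 < d /\ forall s z, 0 <= s < T -> 0 <= z <= M ->
  Rabs (s - t) < d -> Rabs (z - y) < d -> F s z < x + eps).
(* If [x + eps] leaves [0,1], the bound holds because [F] is at most 1. *)
{ destruct (Rlt_dec 1 (x + eps)) as [L|L].
  - exists 1; split; [lra|]; intros s z Hs Hz _ _.
    destruct (HF s z Hs Hz); lra.
  - assert (Lt := slt t x (x + eps) Ht ltac:(lra) ltac:(lra) ltac:(lra)).
    (* Half of the gap [g] absorbs the change of [U] in time, the other half the move from [y] to
       [z]. *)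
    set (g := cumul u t (x + eps) - y).
    destruct (proj1 (continuous_on_R_iff _ _)
      (cumul_continuous_on_time (x + eps) ltac:(lra)) t Ht (g / 2) ltac:(unfold g; lra))
      as [d [Hd K]].
    exists (Rmin d (g / 2)); split; [apply Rmin_pos; auto; unfold g; lra|].
    intros s z Hs Hz Hst Hzy.
    assert (Q1 := Rmin_l d (g / 2)); assert (Q2 := Rmin_r d (g / 2)).
    specialize (K s Hs ltac:(lra)).
    apply Rabs_def2 in K; apply Rabs_def2 in Hzy.
    destruct (HF s z Hs Hz) as [Hxs Es].
    apply Rnot_le_lt; intros C.
    assert (C' := sle s (x + eps) (F s z) Hs ltac:(lra) C ltac:(lra)).
    unfold g in *; lra. }
assert (lo : exists d, 0 < d /\ forall s z, 0 <= s < T -> 0 <= z <= M ->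
  Rabs (s - t) < d -> Rabs (z - y) < d -> x - eps < F s z).
{ destruct (Rlt_dec (x - eps) 0) as [L|L].
  - exists 1; split; [lra|]; intros s z Hs Hz _ _.
    destruct (HF s z Hs Hz); lra.
  - assert (Lt := slt t (x - eps) x Ht ltac:(lra) ltac:(lra) ltac:(lra)).
    set (g := y - cumul u t (x - eps)).
    destruct (proj1 (continuous_on_R_iff _ _)
      (cumul_continuous_on_time (x - eps) ltac:(lra)) t Ht (g / 2) ltac:(unfold g; lra))
      as [d [Hd K]].
    exists (Rmin d (g / 2)); split; [apply Rmin_pos; auto; unfold g; lra|].
    intros s z Hs Hz Hst Hzy.
    assert (Q1 := Rmin_l d (g / 2)); assert (Q2 := Rmin_r d (g / 2)).
    specialize (K s Hs ltac:(lra)).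
    apply Rabs_def2 in K; apply Rabs_def2 in Hzy.
    destruct (HF s z Hs Hz) as [Hxs Es].
    apply Rnot_le_lt; intros C.
    assert (C' := sle s (F s z) (x - eps) Hs ltac:(lra) C ltac:(lra)).
    unfold g in *; lra. }
destruct up as [d1 [P1 K1]]; destruct lo as [d2 [P2 K2]].
exists (Rmin d1 d2); split; [now apply Rmin_pos|].
intros s z [Hs Hz] Hst Hzy.
assert (Q1 := Rmin_l d1 d2); assert (Q2 := Rmin_r d1 d2).
specialize (K1 s z Hs Hz ltac:(lra) ltac:(lra)).
specialize (K2 s z Hs Hz ltac:(lra) ltac:(lra)).
apply Rabs_def1; lra.
Qed.

Lemma density_cont2_on : cont2_on (fun t y => 0 <= t < T /\ 0 <= y <= M)
  (fun t y => u t (F t y)).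
Proof.
apply (continuous_on_comp_cont2 _ (fun t x => 0 <= t < T /\ 0 <= x <= 1)
  (fun p => fst p) (fun p => F (fst p) (snd p)) u).
- apply continuous_on_fst.
- apply inverse_cont2_on.
- intros p [Ht Hy]; split; auto; now apply HF.
- exact u_cont.
Qed.

End Evolution.

(** * The equation for the inverse *)

Section Parabolic.

Variables (a : R -> R) (T M : R) (u ut ux uxx F : R -> R -> R).
Hypothesis a_diff : forall r, 0 < r -> ex_derive a r.
Hypothesis u_cont : cont2_on (fun t x => 0 <= t < T /\ 0 <= x <= 1) u.
Hypothesis u_pos : forall t x, 0 <= t < T -> 0 < x < 1 -> 0 < u t x.
Hypothesis u_dom : forall t x, 0 < t < T -> 0 <= x <= 1 -> 0 < u t x.
Hypothesis u_mass : forall t, 0 <= t < T -> RInt (u t) 0 1 = M.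
Hypothesis u_deriv : forall t x, ioo 0 T t -> icc 0 1 x ->
  is_deriv_on (ioo 0 T) (fun s => u s x) t (ut t x)
  /\ is_deriv_on (icc 0 1) (u t) x (ux t x)
  /\ is_deriv_on (icc 0 1) (ux t) x (uxx t x).
Hypothesis ut_cont : cont2_on (rect (ioo 0 T) (icc 0 1)) ut.
Hypothesis ux_cont : cont2_on (rect (ioo 0 T) (icc 0 1)) ux.
Hypothesis uxx_cont : cont2_on (rect (ioo 0 T) (icc 0 1)) uxx.
Hypothesis ux_0 : forall t, 0 < t < T -> ux t 0 = 0.
Hypothesis ux_1 : forall t, 0 < t < T -> ux t 1 = 0.
Hypothesis u_eq : forall t x, 0 < t < T -> 0 < x < 1 ->
  ut t x
  = Derive (fun z => a (u t z) * ux t z - u t z * (M * z - cumul u t z)) x.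
Hypothesis HF : forall t y, 0 <= t < T -> 0 <= y <= M ->
  0 <= F t y <= 1 /\ cumul u t (F t y) = y.

(** This is [a(u) u_x - u v_x] with the gradient of the potential made explicit. *)
Let flux (t x : R) : R := a (u t x) * ux t x - u t x * (M * x - cumul u t x).

Lemma ioo_Ico (t : R) : ioo 0 T t -> 0 <= t < T.
Proof. unfold ioo; lra. Qed.

Lemma u_deriv_interior (t x : R) : 0 < t < T -> 0 < x < 1 ->
  is_derive (u t) x (ux t x) /\ is_derive (ux t) x (uxx t x).
Proof.
intros Ht Hx; destruct (u_deriv t x Ht) as [_ [H1 H2]]; [unfold icc; lra|].
split; apply (is_derive_of_is_deriv_on (icc 0 1)); auto; now apply locally_icc.
Qed.

Lemma u_deriv_time (t x : R) : 0 < t < T -> 0 <= x <= 1 ->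
  is_derive (fun s => u s x) t (ut t x).
Proof.
intros Ht Hx; destruct (u_deriv t x Ht Hx) as [H _].
apply (is_derive_of_is_deriv_on (ioo 0 T)); auto; now apply locally_ioo.
Qed.

Lemma u_slice (t : R) : 0 <= t < T -> continuous_on (icc 0 1) (u t).
Proof. exact (slice_continuous_on T u u_cont t). Qed.

Lemma ux_slice (t : R) : 0 < t < T -> continuous_on (icc 0 1) (ux t).
Proof.
intros Ht; apply (cont2_on_slice _ ux t (icc 0 1) ux_cont); intros; split; auto.
Qed.

Lemma a_continuous (r : R) : 0 < r -> continuous a r.
Proof. intros Hr; apply (ex_derive_continuous (V := R_NormedModule)); auto. Qed.

Lemma is_derive_cumul (t x : R) : 0 <= t < T -> 0 < x < 1 ->
  is_derive (cumul u t) x (u t x).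
Proof. intros Ht; apply is_derive_primitive; now apply u_slice. Qed.

Lemma cumul_continuous_on (t : R) : 0 <= t < T ->
  continuous_on (icc 0 1) (cumul u t).
Proof. intros Ht; apply primitive_continuous_on; now apply u_slice. Qed.

Lemma is_derive_flux (t x : R) : 0 < t < T -> 0 < x < 1 ->
  is_derive (flux t) x
    (Derive a (u t x) * ux t x ^ 2 + a (u t x) * uxx t x
     - (ux t x * (M * x - cumul u t x) + u t x * (M - u t x))).
Proof.
intros Ht Hx; unfold flux.
destruct (u_deriv_interior t x Ht Hx) as [D1 D2].
assert (D3 := is_derive_cumul t x ltac:(lra) Hx).
assert (Hu : 0 < u t x) by (apply u_dom; lra).
assert (D4 := a_diff _ Hu).
auto_derive.
- repeat split; try (eexists; eassumption); auto.
- rewrite (is_derive_unique _ _ _ D1 : Derive (fun y => u t y) x = _).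
  rewrite (is_derive_unique _ _ _ D2 : Derive (fun y => ux t y) x = _).
  rewrite (is_derive_unique _ _ _ D3 : Derive (fun y => cumul u t y) x = _).
  change (Derive (fun r => a r) (u t x)) with (Derive a (u t x)); ring.
Qed.

Lemma ut_eq (t x : R) : 0 < t < T -> 0 < x < 1 ->
  ut t x = Derive a (u t x) * ux t x ^ 2 + a (u t x) * uxx t x
    - (ux t x * (M * x - cumul u t x) + u t x * (M - u t x)).
Proof.
intros Ht Hx; rewrite u_eq by auto.
exact (is_derive_unique _ _ _ (is_derive_flux t x Ht Hx)).
Qed.

Lemma flux_deriv (t x : R) : 0 < t < T -> 0 < x < 1 ->
  is_derive (flux t) x (ut t x).
Proof. intros Ht Hx; rewrite ut_eq by auto; now apply is_derive_flux. Qed.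

Lemma flux_continuous_on (t : R) : 0 < t < T -> continuous_on (icc 0 1) (flux t).
Proof.
intros Ht; unfold flux; assert (Ht' : 0 <= t < T) by lra.
apply continuous_on_minus; apply continuous_on_mult.
- apply continuous_on_comp_continuous; [now apply u_slice|].
  intros x Hx; apply a_continuous; auto.
- now apply ux_slice.
- now apply u_slice.
- apply continuous_on_minus; [|now apply cumul_continuous_on].
  apply continuous_on_mult; [apply continuous_on_const | apply continuous_on_id].
Qed.

Lemma cumul_at_0 (t : R) : cumul u t 0 = 0.
Proof. apply primitive_at_0. Qed.

Lemma flux_at_0 (t : R) : 0 < t < T -> flux t 0 = 0.
Proof. intros Ht; unfold flux; rewrite ux_0, cumul_at_0 by auto; ring. Qed.

(** Differentiation under the integral gives the integral of [ut], which is the space derivative of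
    the flux; the flux vanishes at 0. *)
Lemma is_derive_cumul_time (t x : R) : 0 < t < T -> 0 <= x <= 1 ->
  is_derive (fun s => cumul u s x) t (flux t x).
Proof.
intros Ht Hx.
(* The parametric integral needs joint continuity of the time derivative on full neighbourhoods,
   also at the ends of the range of integration; the extension in space supplies it. *)
set (us := fun s z => u s (clamp 0 1 z)).
assert (Dus : forall s z, 0 < s < T ->
  is_derive (fun r => us r z) s (ut s (clamp 0 1 z))).
{ intros s z Hs; apply u_deriv_time; auto; apply clamp_icc; lra. }
assert (E : RInt (fun z => Derive (fun r => us r z) t) 0 x = flux t x).
{ transitivity (RInt (ut t) 0 x).
  - apply RInt_ext; rewrite Rmin_left, Rmax_right by lra; intros z Hz.
    transitivity (ut t (clamp 0 1 z)); [now apply is_derive_unique, Dus|].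
    rewrite clamp_id; auto; lra.
  - destruct (Req_dec x 0) as [->|Hx0].
    + rewrite flux_at_0 by auto; apply primitive_at_0.
    + replace (flux t x) with (flux t x - flux t 0) by (rewrite flux_at_0; lra).
      apply is_RInt_unique, is_RInt_of_interior; try lra.
      * apply continuous_on_subset with (2 := flux_continuous_on t Ht).
        apply icc_sub; lra.
      * intros z Hz; apply flux_deriv; lra.
      * apply (cont2_on_slice _ ut t (icc 0 x) ut_cont).
        intros z Hz; split; auto; unfold icc in *; lra. }
rewrite <- E.
apply is_derive_ext_loc with (fun s => RInt (us s) 0 x).
{ apply filter_imp with (2 := locally_ioo 0 T t Ht).
  intros s _; exact (RInt_clamp 0 1 (u s) x Hx). }
apply (is_derive_RInt_param us 0 x t).
- apply filter_imp with (2 := locally_ioo 0 T t Ht).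
  intros s Hs z _; eexists; now apply Dus.
- intros z _.
  apply continuity_2d_pt_ext_loc with (fun s q => ut s (clamp 0 1 q)).
  { destruct (locally_ioo 0 T t Ht) as [d Hd]; exists d; intros s q Hs _.
    symmetry; apply is_derive_unique, Dus, (Hd s Hs). }
  intros e.
  assert (Hc := clamp_icc 0 1 z ltac:(lra)).
  destruct (proj1 (cont2_on_iff _ _) ut_cont t (clamp 0 1 z) (conj Ht Hc) e (cond_pos e))
    as [d1 [Hd1 K]].
  destruct (locally_ioo 0 T t Ht) as [d2 Hd2].
  assert (Hm : 0 < Rmin d1 d2) by (apply Rmin_pos; auto; apply cond_pos).
  exists (mkposreal _ Hm); simpl; intros s q Hs Hq.
  assert (Q1 := Rmin_l d1 d2); assert (Q2 := Rmin_r d1 d2).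
  apply K.
  + split; [apply Hd2; change (Rabs (s - t) < d2); lra | apply clamp_icc; lra].
  + lra.
  + apply Rle_lt_trans with (1 := clamp_lip 0 1 q z); lra.
- apply filter_imp with (2 := locally_ioo 0 T t Ht).
  intros s Hs; apply (ex_RInt_continuous (V := R_CompleteNormedModule)).
  intros z _; apply continuous_clamp; [lra|]; apply u_slice; unfold ioo in Hs; lra.
Qed.

(** * Derivatives of the inverse function *)

Lemma F_cont2_on : cont2_on (fun t y => 0 <= t < T /\ 0 <= y <= M) F.
Proof. exact (inverse_cont2_on T M u u_cont u_pos F HF). Qed.

Lemma F_slice (t : R) : 0 <= t < T -> continuous_on (icc 0 M) (F t).
Proof.
intros Ht; apply (cont2_on_slice _ F t (icc 0 M) F_cont2_on); intros; split; auto.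
Qed.

Lemma F_ioo (t y : R) : 0 <= t < T -> 0 < y < M -> 0 < F t y < 1.
Proof. intros Ht; apply (inverse_ioo (u t) M); auto; intros; now apply HF. Qed.

Lemma F_at_0 (t : R) : 0 <= t < T -> F t 0 = 0.
Proof.
intros Ht; apply (inverse_at_0 (u t) M); auto; now apply u_slice.
Qed.

Lemma F_at_M (t : R) : 0 <= t < T -> F t M = 1.
Proof.
intros Ht; apply (inverse_at_M (u t) M); auto; now apply u_slice.
Qed.

Lemma is_derive_F (t y : R) : 0 <= t < T -> 0 < y < M ->
  is_derive (F t) y (/ u t (F t y)).
Proof.
intros Ht Hy.
apply (is_derive_of_is_deriv_on (icc 0 M)); [now apply locally_icc|].
apply inverse_deriv; auto.
- now apply u_slice.
- now apply F_slice.
- lra.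
- apply u_pos; auto; now apply F_ioo.
Qed.

(** Implicit differentiation by hand. With [z = F s y], both [U(s,z)] and [U(t,x)] equal [y], so the
    mean value theorem in space at time [s] gives [u(s,c) (z - x) = - (U(s,x) - U(t,x))]. Only
    continuity of [F] is then required to pass to the limit. *)
Lemma is_derive_F_time (t y : R) : 0 < t < T -> 0 < y < M ->
  is_derive (fun s => F s y) t (- flux t (F t y) / u t (F t y)).
Proof.
intros Ht Hy; assert (Ht' : 0 <= t < T) by lra.
assert (Hx := F_ioo t y Ht' Hy).
assert (Hyc : 0 <= y <= M) by lra.
destruct (HF t y Ht' Hyc) as [_ Et].
set (x := F t y) in *.
assert (Hc := u_pos t x Ht' Hx).
apply is_derive_Reals; intros eps He.
(* It will be used with [q] the time difference quotient of [U] at the fixed point [x], and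
   [r = u s c]. *)
assert (C : continuity_2d_pt (fun q r => - q / r) (flux t x) (u t x)).
{ apply continuity_2d_pt_mult.
  - apply continuity_2d_pt_opp, continuity_2d_pt_id1.
  - apply continuity_2d_pt_inv; [apply continuity_2d_pt_id2 | lra]. }
destruct (C (mkposreal eps He)) as [d0 K0]; simpl in K0.
destruct (proj1 (is_derive_Reals _ _ _) (is_derive_cumul_time t x Ht ltac:(lra))
  d0 (cond_pos d0)) as [d1 K1].
destruct (proj1 (cont2_on_iff _ _) u_cont t x ltac:(split; lra) d0 (cond_pos d0))
  as [d2 [Hd2 K2]].
destruct (proj1 (cont2_on_iff _ _) F_cont2_on t y (conj Ht' Hyc) d2 Hd2)
  as [d3 [Hd3 K3]].
destruct (locally_ioo 0 T t Ht) as [d4 K4].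
assert (Hm : 0 < Rmin (Rmin d1 d2) (Rmin d3 d4))
  by (repeat apply Rmin_pos; auto; apply cond_pos).
exists (mkposreal _ Hm); simpl; intros h Hh0 Hh.
assert (Q1 := Rmin_l (Rmin d1 d2) (Rmin d3 d4)); assert (Q2 := Rmin_r (Rmin d1 d2) (Rmin d3 d4)).
assert (Q3 := Rmin_l d1 d2); assert (Q4 := Rmin_r d1 d2).
assert (Q5 := Rmin_l d3 d4); assert (Q6 := Rmin_r d3 d4).
set (s := t + h).
assert (Hst : s - t = h) by (unfold s; ring).
assert (Hs : 0 < s < T).
{ apply K4; change (Rabs (s - t) < d4); rewrite Hst; lra. }
assert (Hs' : 0 <= s < T) by lra.
destruct (HF s y Hs' Hyc) as [Hz Es].
specialize (K3 s y (conj Hs' Hyc)); rewrite Hst, Rminus_diag, Rabs_R0 in K3.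
specialize (K3 ltac:(lra) Hd3).
fold x in K3; set (z := F s y) in *.
assert (Hxi : exists c, 0 <= c <= 1 /\ Rabs (c - x) <= Rabs (z - x) /\
  cumul u s z - cumul u s x = u s c * (z - x)).
{ destruct (Req_dec x z) as [E|E].
  (* If [F] has not moved, there is no interval for the mean value theorem, and [c = x] serves. *)
  - exists x; rewrite <- E, !Rminus_diag, Rabs_R0; repeat split; lra.
  - destruct (MVT_slope 0 1 (cumul u s) (u s) x z) as [c [H1 [H2 H3]]]; auto; try lra.
    + now apply cumul_continuous_on.
    + intros; now apply is_derive_cumul.
    + exists c; repeat split; auto; lra. }
destruct Hxi as [c [Hc1 [Hcx E]]].
assert (Hus := u_dom s c Hs Hc1).
specialize (K1 h Hh0 ltac:(lra)); fold s in K1.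
specialize (K2 s c (conj Hs' Hc1)); rewrite Hst in K2.
specialize (K2 ltac:(lra) ltac:(lra)).
change (Rabs ((z - x) / h - - flux t x / u t x) < eps).
replace ((z - x) / h)
  with (- ((cumul u s x - cumul u t x) / h) / u s c); [now apply K0|].
replace (cumul u s x - cumul u t x) with (- (u s c * (z - x))) by lra.
field; lra.
Qed.

(** Chain rule in two variables. Joint differentiability of [u] comes from continuity of the single
    partial derivative [ut] near the point, together with the existence of [ux] at the point; hence
    the restriction to interior [y]. *)
Lemma is_derive_u_F_time (t y : R) : 0 < t < T -> 0 < y < M ->
  is_derive (fun s => u s (F s y)) t
    (ut t (F t y) + ux t (F t y) * (- flux t (F t y) / u t (F t y))).
Proof.
intros Ht Hy.
assert (Hx := F_ioo t y ltac:(lra) Hy).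
assert (DF := is_derive_F_time t y Ht Hy).
set (x := F t y) in *; set (Ft := - flux t x / u t x) in *.
assert (L : locally (t, x) (fun p : R * R => rect (ioo 0 T) (icc 0 1) (fst p) (snd p))).
{ destruct (locally_ioo 0 T t Ht) as [d1 K1].
  destruct (locally_icc 0 1 x Hx) as [d2 K2].
  assert (Hm : 0 < Rmin d1 d2) by (apply Rmin_pos; apply cond_pos).
  assert (Q1 := Rmin_l d1 d2); assert (Q2 := Rmin_r d1 d2).
  exists (mkposreal _ Hm); intros [s z] [Hs Hz]; simpl in Hs, Hz; split; simpl.
  - apply K1; exact (Rlt_le_trans _ _ _ Hs Q1).
  - apply K2; exact (Rlt_le_trans _ _ _ Hz Q2). }
assert (Du : filterdiff (fun p : R * R => u (fst p) (snd p)) (locally (t, x))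
  (fun p : R * R => plus (scal (fst p) (ut t x)) (scal (snd p) (ux t x)))).
{ apply is_derive_filterdiff.
  - apply filter_imp with (2 := L); intros [s z] [Hs Hz]; now apply u_deriv_time.
  - now apply u_deriv_interior.
  - exact (continuous_continuous_on _ _ _ L ut_cont). }
unfold is_derive.
assert (K := filterdiff_comp'_2 (fun s : R => s) (fun s => F s y) u t
  (fun h => h) (fun h => scal h Ft) (fun h k => plus (scal h (ut t x)) (scal k (ux t x)))
  (filterdiff_id _) DF Du).
apply (filterdiff_ext_lin _ _ _ K).
intros h; unfold plus, scal; simpl; unfold mult; simpl; ring.
Qed.

(** * The reciprocal density, its derivatives and its equation *)

Definition reciprocal_density (t y : R) : R := / u t (F t y).

Let f := reciprocal_density.
Let Ft (t y : R) : R := - flux t (F t y) / u t (F t y).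
Let ft (t y : R) : R :=
  - (ut t (F t y) + ux t (F t y) * Ft t y) / u t (F t y) ^ 2.
(** Along [x = F(t,y)], differentiation in [y] is [1/u] times differentiation in [x]. Applied to
    [1/u], this gives [fy]; applied to [- u_x / u^3], it gives [fyy]. *)
Let fy (t y : R) : R := - ux t (F t y) / u t (F t y) ^ 3.
Let fyy (t y : R) : R :=
  - uxx t (F t y) / u t (F t y) ^ 4 + 3 * ux t (F t y) ^ 2 / u t (F t y) ^ 5.

Lemma u_F_pos (t y : R) : 0 < t < T -> 0 <= y <= M -> 0 < u t (F t y).
Proof. intros Ht Hy; apply u_dom; auto; apply HF; auto; lra. Qed.

Lemma cont2_on_comp_F (w : R -> R -> R) :
  cont2_on (rect (ioo 0 T) (icc 0 1)) w ->
  cont2_on (rect (ioo 0 T) (icc 0 M)) (fun t y => w t (F t y)).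
Proof.
apply (continuous_on_comp_cont2 _ (rect (ioo 0 T) (icc 0 1))
  (fun p => fst p) (fun p => F (fst p) (snd p)) w).
- apply continuous_on_fst.
- apply continuous_on_subset with (2 := F_cont2_on).
  intros p [H1 H2]; split; auto; now apply ioo_Ico.
- intros p [H1 H2]; split; auto; refine (proj1 (HF (fst p) (snd p) _ H2)).
  now apply ioo_Ico.
Qed.

Lemma u_cont_open : cont2_on (rect (ioo 0 T) (icc 0 1)) u.
Proof.
apply continuous_on_subset with (2 := u_cont).
intros p [H1 H2]; split; auto; now apply ioo_Ico.
Qed.

Lemma flux_cont2_on : cont2_on (rect (ioo 0 T) (icc 0 M))
  (fun t y => flux t (F t y)).
Proof.
unfold cont2_on.
(* Along [F] the primitive of [u] is simply [y], so its joint continuity need not be discussed. *)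
apply continuous_on_ext with (fun p : R * R =>
  a (u (fst p) (F (fst p) (snd p))) * ux (fst p) (F (fst p) (snd p))
  - u (fst p) (F (fst p) (snd p)) * (M * F (fst p) (snd p) - snd p)).
{ intros [t y] [H1 H2]; simpl in *; unfold flux.
  now rewrite (proj2 (HF t y (ioo_Ico t H1) H2)). }
assert (Cu := cont2_on_comp_F u u_cont_open).
assert (Cx := cont2_on_comp_F ux ux_cont).
apply continuous_on_minus; apply continuous_on_mult; auto.
- apply continuous_on_comp_continuous; [exact Cu|].
  intros p [H1 H2]; now apply a_continuous, u_F_pos.
- apply continuous_on_minus; [|apply continuous_on_snd].
  apply continuous_on_mult; [apply continuous_on_const|].
  apply continuous_on_subset with (2 := F_cont2_on).
  intros p [H1 H2]; split; auto; now apply ioo_Ico.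
Qed.

Lemma f_cont2_on_open : cont2_on (rect (ioo 0 T) (icc 0 M)) f.
Proof.
apply continuous_on_inv; [exact (cont2_on_comp_F u u_cont_open)|].
intros p [H1 H2]; now apply Rgt_not_eq, u_F_pos.
Qed.

Lemma ft_cont2_on : cont2_on (rect (ioo 0 T) (icc 0 M)) ft.
Proof.
assert (Cu := cont2_on_comp_F u u_cont_open).
assert (Pu : forall p : R * R, rect (ioo 0 T) (icc 0 M) (fst p) (snd p) ->
  u (fst p) (F (fst p) (snd p)) <> 0).
{ intros p [H1 H2]; now apply Rgt_not_eq, u_F_pos. }
apply continuous_on_div.
- apply continuous_on_opp, continuous_on_plus; [exact (cont2_on_comp_F ut ut_cont)|].
  apply continuous_on_mult; [exact (cont2_on_comp_F ux ux_cont)|].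
  apply continuous_on_div; auto; apply continuous_on_opp, flux_cont2_on.
- now apply continuous_on_pow.
- intros p Hp; apply pow_nonzero; auto.
Qed.

Lemma fy_cont2_on : cont2_on (rect (ioo 0 T) (icc 0 M)) fy.
Proof.
apply continuous_on_div.
- apply continuous_on_opp; exact (cont2_on_comp_F ux ux_cont).
- apply continuous_on_pow; exact (cont2_on_comp_F u u_cont_open).
- intros p [H1 H2]; now apply pow_nonzero, Rgt_not_eq, u_F_pos.
Qed.

Lemma fyy_cont2_on : cont2_on (rect (ioo 0 T) (icc 0 M)) fyy.
Proof.
apply continuous_on_plus; apply continuous_on_div.
- apply continuous_on_opp; exact (cont2_on_comp_F uxx uxx_cont).
- apply continuous_on_pow; exact (cont2_on_comp_F u u_cont_open).
- intros p [H1 H2]; now apply pow_nonzero, Rgt_not_eq, u_F_pos.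
- apply continuous_on_mult; [apply continuous_on_const|].
  apply continuous_on_pow; exact (cont2_on_comp_F ux ux_cont).
- apply continuous_on_pow; exact (cont2_on_comp_F u u_cont_open).
- intros p [H1 H2]; now apply pow_nonzero, Rgt_not_eq, u_F_pos.
Qed.

Lemma is_derive_comp_F (t y l : R) (g : R -> R) : 0 < t < T -> 0 < y < M ->
  is_derive g (F t y) l -> is_derive (fun z => g (F t z)) y (/ u t (F t y) * l).
Proof.
intros Ht Hy Hg.
apply (is_derive_comp g (F t) y l (/ u t (F t y)) Hg).
apply is_derive_F; auto; lra.
Qed.

Lemma is_derive_f (t y : R) : 0 < t < T -> 0 < y < M -> is_derive (f t) y (fy t y).
Proof.
intros Ht Hy; assert (Hx := F_ioo t y ltac:(lra) Hy).
assert (Pu := u_dom t (F t y) Ht ltac:(lra)).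
destruct (u_deriv_interior t (F t y) Ht Hx) as [D1 _].
replace (fy t y) with (/ u t (F t y) * (- ux t (F t y) / u t (F t y) ^ 2))
  by (unfold fy; field; lra).
apply (is_derive_comp_F t y _ (fun x => / u t x)); auto.
apply is_derive_inv; auto; lra.
Qed.

Lemma is_derive_fy (t y : R) : 0 < t < T -> 0 < y < M -> is_derive (fy t) y (fyy t y).
Proof.
intros Ht Hy; assert (Hx := F_ioo t y ltac:(lra) Hy).
assert (Pu := u_dom t (F t y) Ht ltac:(lra)).
destruct (u_deriv_interior t (F t y) Ht Hx) as [D1 D2].
replace (fyy t y) with (/ u t (F t y) *
  (- uxx t (F t y) / u t (F t y) ^ 3 + 3 * ux t (F t y) ^ 2 / u t (F t y) ^ 4))
  by (unfold fyy; field; lra).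
apply (is_derive_comp_F t y _ (fun x => - ux t x / u t x ^ 3)); auto.
auto_derive.
- repeat split; try (eexists; eassumption).
  assert (0 < u t (F t y) ^ 3) by now apply pow_lt.
  simpl in *; lra.
- rewrite (is_derive_unique _ _ _ D1 : Derive (fun x => u t x) (F t y) = _).
  rewrite (is_derive_unique _ _ _ D2 : Derive (fun x => ux t x) (F t y) = _).
  field; lra.
Qed.

Lemma is_derive_f_time (t y : R) : 0 < t < T -> 0 <= y <= M ->
  is_derive (fun s => f s y) t (ft t y).
Proof.
intros Ht Hy; assert (Pu := u_F_pos t y Ht Hy).
(* On an edge [F] is constant in time, so [f] is [1/u] at a fixed point. The formula [ft] still
   fits, because its transport term [Ft] vanishes with the flux. *)
assert (edge : forall x, 0 <= x <= 1 -> (forall s, 0 < s < T -> F s y = x) ->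
  flux t x = 0 -> is_derive (fun s => f s y) t (ft t y)).
{ intros x Hx EF J0.
  apply is_derive_ext_loc with (fun s => / u s x).
  { apply filter_imp with (2 := locally_ioo 0 T t Ht); intros s Hs.
    unfold f, reciprocal_density; now rewrite EF. }
  unfold ft, Ft; rewrite (EF t Ht), J0; rewrite (EF t Ht) in Pu.
  replace (- (ut t x + ux t x * (- 0 / u t x)) / u t x ^ 2)
    with (- ut t x / u t x ^ 2) by (field; lra).
  apply (is_derive_inv (fun s => u s x)); [now apply u_deriv_time | lra]. }
destruct (Req_dec y 0) as [Y0|Y0].
{ apply (edge 0); [lra | intros; rewrite Y0; apply F_at_0; lra | now apply flux_at_0]. }
destruct (Req_dec y M) as [YM|YM].
{ apply (edge 1); [lra | intros; rewrite YM; apply F_at_M; lra |].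
  (* At [x = 1] the drift [M x - U] is zero precisely because the mass is [M]. *)
  unfold flux; rewrite ux_1 by auto.
  unfold cumul; rewrite u_mass by lra; ring. }
apply (is_derive_inv (fun s => u s (F s y))); [apply is_derive_u_F_time; lra | lra].
Qed.

Lemma f_C12_on : C12_on (ioo 0 T) (icc 0 M) f.
Proof.
exists ft, fy, fyy.
assert (Sl : forall w t, cont2_on (rect (ioo 0 T) (icc 0 M)) w -> 0 < t < T ->
  continuous_on (icc 0 M) (w t)).
{ intros w t Hw Ht; apply (cont2_on_slice _ w t (icc 0 M) Hw); intros; split; auto. }
split; [|repeat split; auto using f_cont2_on_open, ft_cont2_on, fy_cont2_on, fyy_cont2_on].
intros t y Ht Hy; split; [|split].
- apply is_derive_is_deriv_on; now apply is_derive_f_time.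
- apply (is_deriv_on_of_interior 0 M (f t) (fy t)); auto using f_cont2_on_open, fy_cont2_on.
  intros; now apply is_derive_f.
- apply (is_deriv_on_of_interior 0 M (fy t) (fyy t)); auto using fyy_cont2_on, fy_cont2_on.
  intros; now apply is_derive_fy.
Qed.

Lemma f_boundary (t : R) : 0 < t < T ->
  is_deriv_on (icc 0 M) (f t) 0 0 /\ is_deriv_on (icc 0 M) (f t) M 0.
Proof.
intros Ht; assert (Ht' : 0 <= t < T) by lra.
assert (HM : 0 < M) by (apply (mass_pos (u t)); auto; now apply u_slice).
assert (Sl : forall w, cont2_on (rect (ioo 0 T) (icc 0 M)) w ->
  continuous_on (icc 0 M) (w t)).
{ intros w Hw; apply (cont2_on_slice _ w t (icc 0 M) Hw); intros; split; auto. }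
assert (B : forall y, 0 <= y <= M -> is_deriv_on (icc 0 M) (f t) y (fy t y)).
{ intros y Hy; apply (is_deriv_on_of_interior 0 M (f t) (fy t));
    auto using f_cont2_on_open, fy_cont2_on.
  intros; now apply is_derive_f. }
assert (B0 := B 0 ltac:(lra)); assert (B1 := B M ltac:(lra)); unfold fy in B0, B1.
rewrite F_at_0, ux_0 in B0 by auto; rewrite F_at_M, ux_1 in B1 by auto.
replace (- 0 / u t 0 ^ 3) with 0 in B0 by (unfold Rdiv; ring).
replace (- 0 / u t 1 ^ 3) with 0 in B1 by (unfold Rdiv; ring).
auto.
Qed.

(** The fundamental theorem of calculus for [F t], which goes from 0 to 1. *)
Lemma f_mass (t : R) : 0 < t < T -> is_RInt (f t) 0 M 1.
Proof.
intros Ht; assert (Ht' : 0 <= t < T) by lra.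
assert (HM : 0 < M) by (apply (mass_pos (u t)); auto; now apply u_slice).
replace 1 with (F t M - F t 0) by (rewrite F_at_0, F_at_M by auto; ring).
apply is_RInt_of_interior; auto.
- now apply F_slice.
- intros; now apply is_derive_F.
- apply (cont2_on_slice _ f t (icc 0 M) f_cont2_on_open); intros; split; auto.
Qed.

Variable Psi : R -> R.
Hypothesis Psi_deriv : forall r, 0 < r -> is_derive Psi r (/ r ^ 2 * a (/ r)).

(** The drift [M x - U] enters [u_t] through [- u_x (M x - U)] and [F_t] through [+ (M x - U)], so
    it cancels in [u_t + u_x F_t]. What is left of it is [- u (M - u)], which becomes [M f - 1]
    after division by [- u^2]. *)
Lemma f_eq (t y : R) : 0 < t < T -> 0 < y < M ->
  Derive (fun s => f s y) t = Derive_n (fun z => Psi (f t z)) 2 y - 1 + M * f t y.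
Proof.
intros Ht Hy.
rewrite (is_derive_unique _ _ _ (is_derive_f_time t y Ht ltac:(lra))
  : Derive (fun s => f s y) t = _).
(* The first [y]-derivative of [Psi(f)] as a function of [x]: the weight in [Psi'] at [1/u] is
   [u^2 a(u)], and [f_y] is [- u_x / u^3]. *)
set (g := fun x => - a (u t x) * ux t x / u t x).
assert (D1 : forall z, 0 < z < M -> Derive (fun z => Psi (f t z)) z = g (F t z)).
{ intros z Hz; apply is_derive_unique.
  assert (P := u_F_pos t z Ht ltac:(lra)).
  replace (g (F t z)) with (fy t z * (/ f t z ^ 2 * a (/ f t z))).
  - apply (is_derive_comp Psi (f t)).
    + now apply Psi_deriv, Rinv_0_lt_compat.
    + now apply is_derive_f.
  - unfold fy, f, reciprocal_density, g; rewrite Rinv_inv; field; lra. }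
assert (Hx := F_ioo t y ltac:(lra) Hy).
set (x := F t y) in *.
assert (P := u_dom t x Ht ltac:(lra)).
destruct (u_deriv_interior t x Ht Hx) as [U1 U2].
assert (D2 : is_derive (fun z => g (F t z)) y (/ u t x *
  (- (Derive a (u t x) * ux t x ^ 2 + a (u t x) * uxx t x) / u t x
   + a (u t x) * ux t x ^ 2 / u t x ^ 2))).
{ apply (is_derive_comp_F t y _ g); auto; fold x; unfold g.
  auto_derive.
  - repeat split; try (eexists; eassumption); auto; lra.
  - rewrite (is_derive_unique _ _ _ U1 : Derive (fun z => u t z) x = _).
    rewrite (is_derive_unique _ _ _ U2 : Derive (fun z => ux t z) x = _).
    change (Derive (fun r => a r) (u t x)) with (Derive a (u t x)); field; lra. }
assert (E : Derive_n (fun z => Psi (f t z)) 2 y = Derive (fun z => g (F t z)) y).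
{ apply Derive_ext_loc.
  apply filter_imp with (2 := locally_ioo 0 M y Hy); exact D1. }
rewrite E, (is_derive_unique _ _ _ D2 : Derive (fun z => g (F t z)) y = _).
unfold ft, Ft, f, reciprocal_density, flux; fold x.
rewrite ut_eq by auto.
field; lra.
Qed.

End Parabolic.

Theorem proposition1
  (a A : R -> R)
  (ha_pos : forall r, 0 < r -> 0 < a r)
  (ha_C1 : forall r, 0 < r -> ex_derive a r /\ continuous (Derive a) r)
  (hA : forall r, 0 < r -> is_derive A r (a r))
  (T : R) (hT : 0 < T)
  (u0 : R -> R) (hu0 : continuous_on (icc 0 1) u0)
  (M : R) (hM : M = mean u0 0 1)
  (u v : R -> R -> R) (huv : SP_solution a A T u0 u v)
  (hu_pos : forall t x, 0 <= t < T -> 0 < x < 1 -> 0 < u t x)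
  (Psi : R -> R) (hPsi1 : Psi 1 = 0)
  (hPsi : forall r, 0 < r -> is_derive Psi r (/ r ^ 2 * a (/ r))) :
  (forall t, 0 <= t < T ->
     (forall x, 0 <= x <= 1 -> 0 <= cumul u t x <= M)
     /\ (forall y, 0 <= y <= M ->
           exists! x, 0 <= x <= 1 /\ cumul u t x = y))
  /\
  (forall F : R -> R -> R,
     (forall t y, 0 <= t < T -> 0 <= y <= M ->
        0 <= F t y <= 1 /\ cumul u t (F t y) = y) ->
     exists f : R -> R -> R,
       (forall t y, f_dom T M u0 F t y ->
          is_deriv_on (icc 0 M) (F t) y (f t y) /\ 0 < f t y)
       /\ cont2_on (f_dom T M u0 F) f
       /\ (forall y, 0 <= y <= M -> ~ f_dom T M u0 F 0 y ->
             (y = 0 \/ y = M)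
             /\ is_deriv_on (icc 0 M) (F 0) y p_infty
             /\ filterlim (fun p : R * R => f (fst p) (snd p))
                  (within (fun p : R * R => f_dom T M u0 F (fst p) (snd p))
                     (locally (0, y)))
                  (Rbar_locally p_infty))
       /\ C12_on (ioo 0 T) (icc 0 M) f
       /\ (forall t y, 0 < t < T -> 0 < y < M ->
             Derive (fun s => f s y) t
             = Derive_n (fun z => Psi (f t z)) 2 y - 1 + M * f t y)
       /\ (forall t, 0 < t < T ->
             is_deriv_on (icc 0 M) (f t) 0 0
             /\ is_deriv_on (icc 0 M) (f t) M 0)
       /\ (forall y, 0 < y < M -> f 0 y = / u0 (F 0 y))
       /\ (forall t, 0 < t < T -> is_RInt (f t) 0 M 1)).
Proof.
destruct huv as [u_cont [ut [ux [uxx [u_deriv [_ [ut_cont [ux_cont uxx_cont]]]]]]]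
  v_C2 u_dom eq_u eq_v bc init _].
assert (a_diff : forall r, 0 < r -> ex_derive a r) by (intros; now apply ha_C1).
assert (usl : forall t, 0 <= t < T -> continuous_on (icc 0 1) (u t))
  by exact (slice_continuous_on T u u_cont).
(* The initial condition is given on the open interval only; continuity carries it to the ends,
   where [u0] may vanish. *)
assert (uu0 : forall x, 0 <= x <= 1 -> u 0 x = u0 x).
{ apply continuous_on_icc_eq; auto; [lra | apply usl; lra |].
  intros; now apply init. }
assert (v_grad : forall t, 0 < t < T ->
  (forall x, 0 < x < 1 -> Derive (v t) x = M * x - cumul u t x)
  /\ cumul u t 1 = M).
{ intros t Ht; destruct (v_C2 t Ht) as [vx [vxx [Dv [_ [Cvx _]]]]].
  destruct (bc t Ht) as [_ [_ [bc0 bc1]]].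
  assert (vx0 : vx 0 = 0).
  { apply (is_deriv_on_unique 0 1 (v t) 0); auto; try lra.
    apply Dv; unfold icc; lra. }
  assert (vx1 : vx 1 = 0).
  { apply (is_deriv_on_unique 0 1 (v t) 1); auto; try lra.
    apply Dv; unfold icc; lra. }
  destruct (potential_gradient (u t) (v t) vx vxx M) as [E1 E2]; auto.
  - apply usl; lra.
  - rewrite hM; auto.
  - split.
    + intros x Hx; rewrite E1 by auto; apply E2; lra.
    + specialize (E2 1 ltac:(lra)); unfold cumul; lra. }
assert (u_mass : forall t, 0 <= t < T -> RInt (u t) 0 1 = M).
{ intros t Ht; destruct (Req_dec t 0) as [->|Ht0]; [|apply v_grad; lra].
  rewrite hM; unfold mean; rewrite Rminus_0_r, Rdiv_1_r.
  apply RInt_ext; rewrite Rmin_left, Rmax_right by lra; intros x Hx; apply uu0; lra. }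
(* The no-flux condition concerns [A(u)], whose derivative [a(u) u_x] exists up to the ends;
   positivity of [a] turns it into a condition on [u_x]. *)
assert (ux_eq0 : forall t x, 0 < t < T -> 0 <= x <= 1 ->
  is_deriv_on (icc 0 1) (fun z => A (u t z)) x 0 -> ux t x = 0).
{ intros t x Ht Hx H.
  assert (Pu := u_dom t x Ht Hx).
  assert (E : ux t x * a (u t x) = 0).
  { apply (is_deriv_on_unique 0 1 (fun z => A (u t z)) x); auto; try lra.
    apply (is_deriv_on_of_interior 0 1 _ (fun z => ux t z * a (u t z))); auto.
    - apply continuous_on_comp_continuous; [apply usl; lra|].
      intros z Hz; apply (ex_derive_continuous (V := R_NormedModule)).
      eexists; apply hA; auto.
    - intros z Hz; apply (is_derive_comp A (u t)).
      + apply hA, u_dom; auto; lra.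
      + now apply (u_deriv_interior T u ut ux uxx u_deriv).
    - apply continuous_on_mult.
      + now apply (ux_slice T ux).
      + apply continuous_on_comp_continuous; [apply usl; lra|].
        intros z Hz; apply a_continuous; auto. }
  specialize (ha_pos _ Pu); nra. }
assert (u_eq : forall t x, 0 < t < T -> 0 < x < 1 -> ut t x
  = Derive (fun z => a (u t z) * ux t z - u t z * (M * z - cumul u t z)) x).
{ intros t x Ht Hx.
  transitivity (Derive (fun s => u s x) t).
  - symmetry; apply is_derive_unique.
    apply (u_deriv_time T u ut ux uxx u_deriv); auto; lra.
  - rewrite eq_u by auto; apply Derive_ext_loc.
    apply filter_imp with (2 := locally_ioo 0 1 x Hx); intros z Hz.
    rewrite (proj1 (v_grad t Ht) z Hz).
    assert (D : Derive (u t) z = ux t z).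
    { apply is_derive_unique; now apply (u_deriv_interior T u ut ux uxx u_deriv). }
    now rewrite D. }
split.
{ intros t Ht; split; [apply primitive_range; auto|].
  intros y Hy; destruct (primitive_surj (u t) M) with (y := y) as [x [Hx E]]; auto.
  exists x; repeat split; try tauto; intros z [Hz Ez].
  apply (primitive_inj (u t)); auto; unfold cumul in Ez; lra. }
(* At a corner where [u0] vanishes this function takes the default value of [/ 0]; such corners lie
   outside [f_dom]. *)
intros F HF; exists (reciprocal_density u F).
assert (u_F_dom : forall t y, f_dom T M u0 F t y -> 0 < u t (F t y)).
{ intros t y [Ht [Hy H0]]; destruct (HF t y Ht Hy) as [Hx _].
  destruct (Req_dec t 0) as [E|E]; [|apply u_dom; auto; lra].
  rewrite E in *; rewrite uu0; auto. }
assert (uF_cont := density_cont2_on T M u u_cont hu_pos F HF).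
split; [|split; [|split; [|split; [|split; [|split; [|split]]]]]].
- intros t y D; assert (P := u_F_dom t y D); destruct D as [Ht [Hy _]].
  split; [|now apply Rinv_0_lt_compat].
  apply inverse_deriv; auto; now apply (F_slice T M u).
- apply continuous_on_inv.
  + apply continuous_on_subset with (2 := uF_cont); intros p [H1 [H2 _]]; auto.
  + intros p D; now apply Rgt_not_eq, u_F_dom.
- intros y Hy N; assert (H0T : 0 <= 0 < T) by lra.
  destruct (HF 0 y H0T Hy) as [Hx _].
  assert (Hle : u 0 (F 0 y) <= 0).
  { rewrite uu0 by auto; apply Rnot_lt_le; intros L; apply N.
    split; [|split]; auto. }
  assert (Hge : 0 <= u 0 (F 0 y)).
  { apply (continuous_on_icc_nonneg 0 1 (u 0)); auto; try lra.
    intros; now apply Rlt_le, hu_pos. }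
  assert (Hz : u 0 (F 0 y) = 0) by lra.
  split; [|split].
  (* For any other [y], [F 0 y] would be interior, where [u 0] is positive. *)
  + destruct (Req_dec y 0) as [|Y0]; auto; destruct (Req_dec y M) as [|YM]; auto.
    assert (Hi := F_ioo T M u F u_mass HF 0 y H0T ltac:(lra)).
    assert (P := hu_pos 0 _ H0T Hi); lra.
  + apply (inverse_deriv_infty (u 0)); auto; now apply (F_slice T M u).
  + intros P [B HB].
    (* Where the density is below [m], its reciprocal exceeds [B]; continuity of the density up to
       the corner provides the neighbourhood. *)
    set (m := / (Rabs B + 1)).
    assert (Hm : 0 < m) by (apply Rinv_0_lt_compat; assert (K := Rabs_pos B); lra).
    destruct (proj1 (cont2_on_iff _ _) uF_cont 0 y (conj H0T Hy) m Hm) as [d [Hd K]].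
    exists (mkposreal d Hd); intros [t z] [Ht1 Hz1] D; apply HB; simpl in *.
    assert (Pu := u_F_dom t z D); destruct D as [Ht [Hz' _]].
    specialize (K t z (conj Ht Hz') Ht1 Hz1).
    rewrite Hz, Rminus_0_r, Rabs_pos_eq in K by lra.
    apply Rinv_lt_contravar in K; [|now apply Rmult_lt_0_compat].
    unfold m in K; rewrite Rinv_inv in K; assert (KB := Rle_abs B).
    unfold reciprocal_density; lra.
- eapply f_C12_on; eauto; intros t Ht; apply ux_eq0; try lra; now apply bc.
- intros t y; eapply f_eq; eauto; intros s Hs; apply ux_eq0; try lra; now apply bc.
- intros t; eapply f_boundary; eauto; intros s Hs; apply ux_eq0; try lra; now apply bc.
- intros y Hy; unfold reciprocal_density; rewrite uu0; auto.
  apply HF; lra.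
- intros t; eapply f_mass; eauto; intros s Hs; apply ux_eq0; try lra; now apply bc.
Qed.
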